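(* Let $n,m,k$ be positive integers, $\lambda\ge0$, $D\in\mathbb{R}^{n\times m}$, and for $i\in\mathcal{I}$ let $E_i\in\mathbb{R}^{n\times m}$, $b_i\in\mathbb{R}$. Let $H=\mathrm{Diag}(H_1,\dots,H_n)\in\mathcal{S}^{nm}$ be block diagonal with $H_j\in\mathcal{S}^m$, and for each $i\in\mathcal{I}$ let $Q_i=\mathrm{Diag}(Q_{i,1},\dots,Q_{i,n})\in\mathcal{S}^{nm}$ be block diagonal with $Q_{i,j}\in\mathcal{S}^m$. Then the problem $$\begin{aligned}\min_{Y\in\mathcal{S}^n_+:\,Y\preceq I_n,\,\mathrm{tr}(Y)\le k}\ \min_{X\in\mathbb{R}^{n\times m},\,W_{x,x}\in\mathcal{S}^{nm}_+}\quad & \lambda\,\mathrm{tr}(Y)+\langle W_{x,x},H\rangle+\langle D,X\rangle \\ \text{s.t.}\quad & W_{x,x}\succeq\mathrm{vec}(X^\top)\mathrm{vec}(X^\top)^\top, \\ & \langle Q_i,W_{x,x}\rangle+\langle E_i,X\rangle\le b_i\ \ \forall i\in\mathcal{I}, \\ & \begin{pmatrix}\sum_{i\in[n]}W_{x,x}^{(i,i)} & X^\top \\ X & Y\end{pmatrix}\succeq0\end{aligned}$$ attains the same optimal value as $$\begin{aligned}\min_{Y\in\mathrm{Conv}(\mathcal{Y}^k_n)}\ \min_{X\in\mathbb{R}^{n\times m},\,S^1,\dots,S^n\in\mathcal{S}^m_+}\quad & \langle D,X\rangle+\sum_{i=1}^n\langle H_i,S^i\rangle+\lambda\,\mathrm{tr}(Y)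 \\ \text{s.t.}\quad & S^i\succeq X_{i,.}X_{i,.}^\top\ \ \forall i\in[n],\qquad\begin{pmatrix}\sum_{i=1}^nS^i & X^\top \\ X & Y\end{pmatrix}\succeq0, \\ & \sum_{j=1}^n\langle Q_{i,j},S^j\rangle+\langle E_i,X\rangle\le b_i\ \ \forall i\in\mathcal{I}.\end{aligned}$$
   Context: $\mathcal{S}^d$ (resp. $\mathcal{S}^d_+$) is the set of $d\times d$ real symmetric (resp. positive semidefinite) matrices; $\langle\cdot,\cdot\rangle$ is the trace inner product; $[n]=\{1,\dots,n\}$; $\mathrm{vec}$ stacks columns, so $\mathrm{vec}(X^\top)$ stacks the rows of $X$; $X_{i,.}\in\mathbb{R}^m$ is the column vector containing the $i$th row of $X$. $W_{x,x}$ is partitioned into an $n\times n$ array of $m\times m$ blocks $W_{x,x}^{(i,j)}$. $\mathcal{Y}_n^k:=\{Y\in\mathcal{S}^n_+:Y^2=Y,\ \mathrm{tr}(Y)\le k\}$, whose convex hull is $\mathrm{Conv}(\mathcal{Y}_n^k)=\{P\in\mathcal{S}^n_+:P\preceq I_n,\ \mathrm{tr}(P)\le k\}$. Optimal values are infima in $[-\infty,+\infty]$. *)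

(* Defs.v *)
From HB Require Import structures.
From mathcomp Require Import all_boot all_order all_algebra.
From mathcomp Require Import boolp classical_sets reals ereal convex.

Set Implicit Arguments.
Unset Strict Implicit.
Unset Printing Implicit Defensive.

Import Order.TTheory GRing.Theory Num.Theory.

Local Open Scope classical_set_scope.
Local Open Scope ring_scope.

Definition inner (R : realType) (p q : nat) (A B : 'M[R]_(p, q)) : R :=
  \tr (A^T *m B).

Definition psd (R : realType) (p : nat) : set 'M[R]_p :=
  [set A | A \is symmetricmx /\
           forall v : 'cV[R]_p, 0 <= (v^T *m A *m v) 0 0].

Definition loewner_le (R : realType) (p : nat) (A B : 'M[R]_p) : Prop :=
  psd (B - A).

(* Column stacking.  The space of dimension nm is presented as
   \sum_(j < n) m, the size expected by mathcomp's block matrices. *)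
Definition vec (R : realType) (m n : nat) (A : 'M[R]_(m, n)) :
    'cV[R]_(\sum_(j < n) m) :=
  \mxcol_(j < n) col j A.

Definition diag_block (R : realType) (n m : nat)
    (W : 'M[R]_(\sum_(j < n) m)) (i : 'I_n) : 'M[R]_m :=
  @submxblock R n n (fun=> m) (fun=> m) W i i.

Definition row_vec (R : realType) (n m : nat) (X : 'M[R]_(n, m)) (i : 'I_n) :
    'cV[R]_m :=
  (row i X)^T.

Definition convex_hull (R : realType) (M : lmodType R) (A : set M) : set M :=
  smallest (@convex_set R M) A.

Definition proj_rank_le (R : realType) (n k : nat) : set 'M[R]_n :=
  [set Y | [/\ psd Y, Y *m Y = Y & \tr Y <= k%:R]].

(* In both problems the infimum over an infeasible set is +oo. *)
Definition value_full (R : realType) (n m k : nat) (lambda : R)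
    (D : 'M[R]_(n, m)) (H : 'M[R]_(\sum_(j < n) m)) (I : Type)
    (Q : I -> 'M[R]_(\sum_(j < n) m)) (E : I -> 'M[R]_(n, m)) (b : I -> R) :
    \bar R :=
  ereal_inf
    [set ereal_inf
       [set v : \bar R |
         exists (X : 'M[R]_(n, m)) (W : 'M[R]_(\sum_(j < n) m)),
           [/\ psd W,
               loewner_le (vec X^T *m (vec X^T)^T) W,
               forall i : I, inner (Q i) W + inner (E i) X <= b i,
               psd (block_mx (\sum_(i < n) diag_block W i) X^T X Y) &
               v = (lambda * \tr Y + inner W H + inner D X)%:E]]
    | Y in [set Y : 'M[R]_n |
             [/\ psd Y, loewner_le Y 1%:M & \tr Y <= k%:R]]].

Definition value_reduced (R : realType) (n m k : nat) (lambda : R)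
    (D : 'M[R]_(n, m)) (H : 'I_n -> 'M[R]_m) (I : Type)
    (Q : I -> 'I_n -> 'M[R]_m) (E : I -> 'M[R]_(n, m)) (b : I -> R) :
    \bar R :=
  ereal_inf
    [set ereal_inf
       [set v : \bar R |
         exists (X : 'M[R]_(n, m)) (S : 'I_n -> 'M[R]_m),
           [/\ forall i, psd (S i) /\
                 loewner_le (row_vec X i *m (row_vec X i)^T) (S i),
               psd (block_mx (\sum_(i < n) S i) X^T X Y),
               forall i : I,
                 \sum_(j < n) inner (Q i j) (S j) + inner (E i) X <= b i &
               v = (inner D X + \sum_(i < n) inner (H i) (S i)
                    + lambda * \tr Y)%:E]]
    | Y in convex_hull (@proj_rank_le R n k)].

(* Main.v *)
Require Import Defs.
From HB Require Import structures.
From mathcomp Require Import all_boot all_order all_algebra.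
From mathcomp Require Import boolp classical_sets reals ereal convex.
From mathcomp Require Import interval_inference complex.
From mathcomp Require Import ring lra.

Import Order.TTheory GRing.Theory Num.Theory.

Local Open Scope ring_scope.

(** The two problems have the same outer feasible set and, for each fixed Y, the
    same set of attainable objective values.

    For the outer sets, the convex hull of the projections of rank at most k is
    the set of Y with 0 <= Y <= 1 and trace at most k ([convex_hull_proj]).  One
    inclusion holds because the latter set is convex and contains the
    projections.  For the other, the spectral theorem
    ([symmetric_spectral]) reduces the claim to vectors of eigenvalues: the
    points of the cube with sum at most k are convex combinations of its 0/1
    points with sum at most k ([hypersimplex_sub_convex]).

    For the inner problems, objective and constraints see W only through its
    diagonal blocks, except for W >= vec(X^T) vec(X^T)^T.  The diagonal blocks
    of a feasible W are feasible, since taking a diagonal block preserves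
    semidefiniteness and turns vec(X^T) vec(X^T)^T into the outer products of
    the rows x_i of X ([diag_block_vec]).  Conversely, feasible S^i are the
    diagonal blocks of
    W = vec(X^T) vec(X^T)^T + Diag(S^1 - x_1 x_1^T, ..., S^n - x_n x_n^T),
    whose two summands are positive semidefinite, so W is feasible with the same
    objective value. *)

(** * Spectral decomposition of real symmetric matrices *)

Lemma symmetricmxP {R : fieldType} {p : nat} {A : 'M[R]_p} :
  reflect (A^T = A) (A \is symmetricmx).
Proof.
rewrite is_hermitianmxE expr0 scale1r map_mx_id //.
by rewrite eq_sym; apply: eqP.
Qed.

(** Over the complex numbers A is Hermitian, hence unitarily diagonalizable with
    real eigenvalues; they cannot all vanish when A does not, and a real root of
    the characteristic polynomial over the complex numbers is a root over the
    reals. *)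
Lemma symmetric_nonzero_eigenvalue {R : rcfType} {n : nat} (A : 'M[R]_n) :
  A^T = A -> A != 0 -> exists2 a, a != 0 & eigenvalue A a.
Proof.
move=> Asym A0; pose AC : 'M[R[i]%C]_n := map_mx (real_complex R) A.
have ACherm : AC \is hermsymmx.
  apply/is_hermitianmxP; rewrite expr0 scale1r.
  apply/matrixP => i j; rewrite !mxE.
  by move/matrixP/(_ i j): Asym; rewrite mxE => ->; apply/esym/conjc_real.
have /mxOverP dreal := hermitian_spectral_diag_real ACherm.
have /hermitian_normalmx /orthomx_spectralP ACE := ACherm.
set P := spectralmx AC in ACE; set d := spectral_diag AC in ACE dreal.
have Pu : P \in unitmx by exact: spectral_unit.
have /rV0Pn [j dj0] : d != 0.
  apply: contraNneq A0 => d0; move: ACE.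
  rewrite d0 (_ : diag_mx 0 = 0) ?mulmx0 ?mul0mx; last first.
    by apply/matrixP => i j; rewrite !mxE mul0rn.
  by move/eqP; rewrite map_mx_eq0.
have /complex_realP [a djE] := dreal 0 j.
have rootAC : eigenvalue AC (d 0 j).
  apply/eigenvalueP; exists (row j P).
    rewrite -row_mul {1}ACE !mulmxA mulmxV // mul1mx row_mul row_diag_mx.
    by rewrite -scalemxAl -rowE.
  apply: contraTneq Pu => Pj0; rewrite -row_free_unit.
  by apply/row_freePn; exists j; rewrite Pj0 sub0mx.
exists a; first by apply: contraNneq dj0 => a0; rewrite djE a0.
rewrite eigenvalue_root_char -(fmorph_root (real_complex R)) map_char_poly.
by rewrite -eigenvalue_root_char; move: rootAC; rewrite djE.
Qed.

(** Deflation: a unit eigenvector u for a nonzero eigenvalue a lies in the row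
    space of A but not in that of A - a u^T u, which u annihilates, so
    subtracting a u^T u lowers the rank.  Keeping only nonzero eigenvalues in d
    is what makes the eigenvectors found later orthogonal to u. *)
Lemma symmetric_spectral {R : rcfType} {n : nat} (A : 'M[R]_n) : A^T = A ->
  exists r (V : 'M[R]_(r, n)) (d : 'rV[R]_r),
    V *m V^T = 1%:M /\ A = V^T *m diag_mx d *m V /\ forall i, d 0 i != 0.
Proof.
have [s] := ubnP (\rank A); elim: s A => // s IHs A rA Asym.
have [->|A0] := eqVneq A 0.
  exists 0, 0, 0; split; first by apply/matrixP => -[].
  by split; [rewrite mulmx0 | case].
have [a a0 /eigenvalueP [v vA v0]] := symmetric_nonzero_eigenvalue A Asym A0.
pose q := (v *m v^T) 0 0.
have q0 : 0 < q.
  have qE : q = \sum_j v 0 j ^+ 2.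
    by rewrite /q mxE; apply: eq_bigr => j _; rewrite mxE expr2.
  have [j vj0] := rV0Pn _ v0.
  rewrite qE (bigD1 j) //= ltr_pwDl ?exprn_even_gt0 //.
  by apply: sumr_ge0 => *; apply: sqr_ge0.
pose u := (Num.sqrt q)^-1 *: v.
have uA : u *m A = a *: u by rewrite -scalemxAl vA !scalerA mulrC.
have uu : u *m u^T = 1%:M.
  rewrite linearZ /= -scalemxAl -scalemxAr scalerA [v *m _]mx11_scalar -/q.
  rewrite scale_scalar_mx -invfM -expr2 sqr_sqrtr ?(ltW q0) //.
  by rewrite mulVf ?gt_eqF.
have Au : A *m u^T = a *: u^T by rewrite -{1}Asym -trmx_mul uA linearZ.
pose A' := A - a *: (u^T *m u).
have A'sym : A'^T = A' by rewrite /A' linearB linearZ /= trmx_mul trmxK Asym.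
have A'u : A' *m u^T = 0.
  by rewrite mulmxBl Au -scalemxAl -mulmxA uu mulmx1 subrr.
have uE : u = a^-1 *: u *m A by rewrite -scalemxAl uA scalerA mulVf // scale1r.
have sA : (A' <= A)%MS.
  rewrite addmx_sub ?eqmx_opp // scalemx_sub //.
  by rewrite uE mulmxA submxMl.
have nuA' : ~~ (u <= A')%MS.
  apply/negP => /submxP [w uw]; move: uu.
  rewrite {1}uw -mulmxA A'u mulmx0 => /matrixP /(_ 0 0).
  by rewrite !mxE eqxx => /eqP; rewrite eq_sym oner_eq0.
have rA' : (\rank A' < s)%N.
  apply: leq_trans (rank_ltmx _) rA.
  rewrite ltmxE sA /=.
  by apply: contra nuA' => AA'; apply: submx_trans AA'; rewrite uE submxMl.
have [r [V [d [VV [A'E d0]]]]] := IHs A' rA' A'sym.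
(* V (A' u^T) = d (V u^T), and the left-hand side is zero. *)
have Vu : V *m u^T = 0.
  have : diag_mx d *m (V *m u^T) = 0.
    by rewrite -[diag_mx d]mul1mx -VV -!mulmxA (mulmxA V^T) (mulmxA _ V) -A'E
      A'u mulmx0.
  move=> dV; apply/matrixP => i j; move/matrixP/(_ i j): dV.
  rewrite mul_diag_mx mxE [RHS]mxE => /eqP.
  by rewrite mulf_eq0 (negPf (d0 i)) [X in _ -> _ = X]mxE => /eqP.
exists (1 + r)%N, (col_mx u V), (row_mx a%:M d); split; last split.
- rewrite tr_col_mx mul_col_row uu Vu VV -[u *m V^T]trmxK trmx_mul trmxK Vu.
  by rewrite trmx0 -scalar_mx_block.
- rewrite diag_mx_row tr_col_mx mul_row_block mul_row_col !mulmx0 addr0 add0r.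
  rewrite -A'E /A' (_ : diag_mx _ = a%:M); last first.
    by apply/matrixP => i j; rewrite !ord1 !mxE.
  by rewrite mul_mx_scalar -scalemxAl addrC subrK.
- move=> i; case: (split_ordP i) => j ->; last by rewrite row_mxEr.
  by rewrite row_mxEl ord1 mxE eqxx mulr1n.
Qed.

(** * Points of a hypersimplex as convex combinations of 0/1 points *)

Lemma convex_setP {R : numDomainType} {M : lmodType R}
    {C : set (convex_lmodType M)} :
  convex_set C <-> forall (x y : M) (t : R),
    0 <= t -> t <= 1 -> C x -> C y -> C (t *: x + (1 - t) *: y).
Proof.
split=> cC x y t => [t0 t1 Cx Cy|].
  by have := cC x y (Itv01 t0 t1); rewrite !inE => /(_ Cx Cy).
by rewrite !inE => Cx Cy; exact: cC.
Qed.

Lemma convex_between {R : realFieldType} {M : lmodType R}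
    {C : set (convex_lmodType M)} (x w : M) (a b : R) :
  convex_set C -> 0 < a -> 0 < b -> C (x + b *: w) -> C (x - a *: w) -> C x.
Proof.
move=> cC a0 b0 Cp Cm.
have ab0 : 0 < a + b by rewrite addr_gt0.
have t0 : 0 <= a / (a + b) by rewrite divr_ge0 ?ltW.
have t1 : a / (a + b) <= 1 by rewrite ler_pdivrMr // mul1r lerDl ltW.
have := convex_setP.1 cC _ _ _ t0 t1 Cp Cm.
rewrite !scalerDr addrACA -scalerDl addrC -[1 - _ in X in C X]opprB.
rewrite scaleNr scalerN opprK !scalerA -scalerDl.
rewrite (_ : _ + (a / (a + b) - 1) * a = 0); last by field; rewrite gt_eqF.
by rewrite scale0r add0r opprB addrC subrK scale1r.
Qed.

(** The usual hypersimplex fixes the sum to be k; here k only bounds it. *)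
Definition hypersimplex {R : numDomainType} (r k : nat) : set 'rV[R]_r :=
  fun x => (forall i, 0 <= x 0 i <= 1) /\ \sum_i x 0 i <= k%:R.

Definition fractional {R : numDomainType} {r} (x : 'rV[R]_r) : {set 'I_r} :=
  [set i | (x 0 i != 0) && (x 0 i != 1)].

Lemma fractional_itv {R : numDomainType} {r k} (x : 'rV[R]_r) i :
  hypersimplex r k x -> i \in fractional x -> 0 < x 0 i < 1.
Proof.
move=> [x01 _]; rewrite inE => /andP[x0 x1].
by have /andP[? ?] := x01 i; rewrite !lt_neqAle eq_sym x0 x1; apply/andP.
Qed.

(** Moving mass b from coordinate j to coordinate i keeps the sum; the largest
    b that stays in the cube makes one of the two coordinates integral. *)
Lemma hypersimplex_transfer {R : realFieldType} {r k} (x : 'rV[R]_r) i j :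
  hypersimplex r k x -> i \in fractional x -> j \in fractional x -> i != j ->
  exists2 b, 0 < b &
    let y := x + b *: (delta_mx 0 i - delta_mx 0 j) in
    hypersimplex r k y /\ (#|fractional y| < #|fractional x|)%N.
Proof.
move=> hx fi fj ij; have [x01 xk] := hx.
have /andP[xi0 xi1] := fractional_itv x i hx fi.
have /andP[xj0 xj1] := fractional_itv x j hx fj.
pose b := Num.min (1 - x 0 i) (x 0 j).
have b0 : 0 < b by rewrite lt_min subr_gt0 xi1.
have [bi bj] : b <= 1 - x 0 i /\ b <= x 0 j.
  by rewrite !ge_min !lexx orbT.
exists b => // y.
have yi : y 0 i = x 0 i + b.
  by rewrite !mxE !eqxx /= (negPf ij) subr0 mulr1.
have yj : y 0 j = x 0 j - b.
  by rewrite !mxE !eqxx /= eq_sym (negPf ij) sub0r mulrN1.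
have yl l : l != i -> l != j -> y 0 l = x 0 l.
  by move=> li lj; rewrite !mxE !eqxx /= (negPf li) (negPf lj) subrr mulr0 addr0.
split; first split.
- move=> l; have [->|li] := eqVneq l i.
    by rewrite yi; apply/andP; split; lra.
  have [->|lj] := eqVneq l j; first by rewrite yj; apply/andP; split; lra.
  by rewrite yl.
- rewrite (bigD1 i) //= (bigD1 j) 1?eq_sym //= yi yj.
  move: xk; rewrite (bigD1 i) //= (bigD1 j) 1?eq_sym //=.
  have -> : \sum_(l | (l != i) && (l != j)) y 0 l =
      \sum_(l | (l != i) && (l != j)) x 0 l.
    by apply: eq_bigr => l /andP[li lj]; exact: yl.
  by lra.
- apply/proper_card/properP; split.
    apply/fintype.subsetP => l; rewrite [l \in _]inE.
    have [->|li] := eqVneq l i; first by [].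
    have [->|lj] := eqVneq l j; first by [].
    by rewrite yl // inE.
  have [bE|bE] : b = 1 - x 0 i \/ b = x 0 j.
    by rewrite /b; case: leP; [left|right].
  + by exists i => //; rewrite inE yi bE addrC subrK eqxx andbF.
  + by exists j => //; rewrite inE yj bE subrr eqxx.
Qed.

(** A point with fractional coordinates lies strictly between two points of the
    hypersimplex with fewer of them.  With at least two fractional coordinates
    these come from transferring mass in the two opposite directions.  With a
    single one, rounding it down or up works: the other coordinates have an
    integral sum that is less than k, so rounding up does not exceed k. *)
Lemma hypersimplex_sub_convex {R : realFieldType} {r k}
    (C : set (convex_lmodType 'rV[R]_r)) : convex_set C ->
  (forall x, hypersimplex r k x -> fractional x = finset.set0 -> C x) ->
  (forall x, hypersimplex r k x -> C x).
Proof.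
move=> cC C01 x; have [s] := ubnP #|fractional x|.
elim: s x => // s IHs x fxs hx; have [x01 xk] := hx.
have [fx0|[i fi]] := finset.set_0Vmem (fractional x); first exact: C01.
have [fxi|[j]] := finset.set_0Vmem (fractional x :\ i).
  have fxE : fractional x = [set i]%SET.
    by rewrite -(finset.setD1K fi) fxi finset.setU0.
  have /andP[xi0 xi1] := fractional_itv x i hx fi.
  pose w : 'rV[R]_r := delta_mx 0 i.
  have xl l : l != i -> (x 0 l == 0) || (x 0 l == 1).
    move=> li; have : l \notin fractional x by rewrite fxE inE.
    by rewrite inE negb_and !negbK.
  have rest : \sum_(l | l != i) x 0 l
      = (#|[set l | (l != i) && (x 0 l == 1)]|)%:R.
    rewrite -sum1_card natr_sum big_mkcond [RHS]big_mkcond /=.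
    apply: eq_bigr => l _; rewrite inE; case: ifP => //= li.
    by case/orP: (xl l li) => /eqP ->; rewrite ?eqxx // eq_sym oner_eq0.
  have restk : \sum_(l | l != i) x 0 l + 1 <= k%:R.
    move: xk; rewrite (bigD1 i) //= rest => xk.
    rewrite -[1]/(1%:R) -natrD ler_nat addn1 -(@ltr_nat R); lra.
  have pt c : 0 <= c <= 1 -> (c == 0) || (c == 1) ->
      C (x + (c - x 0 i) *: w).
    move=> c01 cE; set y := x + _.
    have yi : y 0 i = c by rewrite !mxE !eqxx mulr1 addrC subrK.
    have yl l : l != i -> y 0 l = x 0 l.
      by move=> li; rewrite !mxE (negPf li) andbF mulr0 addr0.
    apply: C01; first split.
    - by move=> l; have [->|li] := eqVneq l i; rewrite ?yi ?yl.
    - rewrite (bigD1 i) //= yi (eq_bigr (fun l => x 0 l) yl).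
      by case/andP: c01 => *; lra.
    - apply/setP => l; rewrite !inE; apply/negbTE; rewrite negb_and !negbK.
      by have [->|li] := eqVneq l i; rewrite ?yi ?yl ?xl.
  apply: (@convex_between _ _ C x w (x 0 i) (1 - x 0 i)) => //; first lra.
    by apply: pt; rewrite ?ler01 ?lexx ?eqxx ?orbT.
  by rewrite -scaleNr -sub0r; apply: pt; rewrite ?ler01 ?lexx ?eqxx.
rewrite !inE => /andP[ji fj].
have {}fj : j \in fractional x by rewrite inE.
have ij : i != j by rewrite eq_sym.
have [b b0 [hp fp]] := hypersimplex_transfer x i j hx fi fj ij.
have [a a0 [hm fm]] := hypersimplex_transfer x j i hx fj fi ji.
apply: (@convex_between _ _ C x (delta_mx 0 i - delta_mx 0 j) a b) => //.
  by apply: IHs hp; apply: leq_trans fp _.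
by rewrite -scalerN opprB; apply: IHs hm; apply: leq_trans fm _.
Qed.

(** * Positive semidefinite matrices and the hull of the projections *)

Lemma psdP {R : realType} {p} (A : 'M[R]_p) :
  psd A <-> A^T = A /\ forall v : 'cV[R]_p, 0 <= (v^T *m A *m v) 0 0.
Proof. by split=> -[/symmetricmxP]. Qed.

Lemma psdD {R : realType} {p} (A B : 'M[R]_p) : psd A -> psd B -> psd (A + B).
Proof.
move=> /psdP[As Ap] /psdP[Bs Bp]; apply/psdP; split=> [|v].
  by rewrite linearD /= As Bs.
by rewrite mulmxDr mulmxDl mxE addr_ge0.
Qed.

Lemma psdZ {R : realType} {p} (a : R) (A : 'M[R]_p) :
  0 <= a -> psd A -> psd (a *: A).
Proof.
move=> a0 /psdP[As Ap]; apply/psdP; split=> [|v]; first by rewrite linearZ /= As.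
by rewrite -scalemxAr -scalemxAl mxE mulr_ge0.
Qed.

Lemma psd_congr {R : realType} {p q} (B : 'M[R]_(p, q)) (A : 'M[R]_p) :
  psd A -> psd (B^T *m A *m B).
Proof.
move=> /psdP[As Ap]; apply/psdP; split=> [|v].
  by rewrite !trmx_mul trmxK As mulmxA.
by have := Ap (B *m v); rewrite trmx_mul !mulmxA.
Qed.

Lemma psd_diag {R : realType} {p} (d : 'rV[R]_p) :
  (forall i, 0 <= d 0 i) -> psd (diag_mx d).
Proof.
move=> d0; apply/psdP; split=> [|v]; first by rewrite tr_diag_mx.
rewrite -mulmxA mxE sumr_ge0 // => i _.
by rewrite mul_diag_mx !mxE mulrCA mulr_ge0 // -expr2 sqr_ge0.
Qed.

Lemma psd1 {R : realType} {p} : @psd R p 1%:M.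
Proof.
by rewrite -diag_const_mx; apply: psd_diag => i; rewrite mxE ler01.
Qed.

Lemma psd_gram {R : realType} {p q} (B : 'M[R]_(p, q)) : psd (B *m B^T).
Proof. by rewrite -{1}[B]trmxK -[B^T^T]mulmx1; apply/psd_congr/psd1. Qed.

(** This is the Fantope of convex optimization, with the trace bounded by k
    rather than equal to k. *)
Definition fantope {R : realType} (n k : nat) : set 'M[R]_n :=
  fun Y => [/\ psd Y, loewner_le Y 1%:M & \tr Y <= k%:R].

Lemma fantope_convex {R : realType} (n k : nat) :
  @convex_set R 'M[R]_n (fantope n k).
Proof.
apply/convex_setP => X Y t t0 t1 [X0 X1 Xk] [Y0 Y1 Yk].
have t'0 : 0 <= 1 - t by rewrite subr_ge0.
split.
- by apply: psdD; apply: psdZ.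
- rewrite /loewner_le (_ : _ - _ = t *: (1%:M - X) + (1 - t) *: (1%:M - Y)).
    by apply: psdD; apply: psdZ.
  by rewrite !scalerBr addrACA -scalerDl -opprD [t + _]addrC subrK scale1r.
- rewrite linearD !linearZ /=.
  apply: le_trans (lerD (ler_wpM2l t0 Xk) (ler_wpM2l t'0 Yk)) _.
  by rewrite -mulrDl [t + _]addrC subrK mul1r.
Qed.

(** The complement 1 - Y of an orthogonal projection is again one, hence a Gram
    matrix. *)
Lemma proj_rank_le_fantope {R : realType} (n k : nat) (Y : 'M[R]_n) :
  @proj_rank_le R n k Y -> fantope n k Y.
Proof.
move=> [Y0 YY Yk]; split=> //; rewrite /loewner_le.
have [Ys _] := (psdP Y).1 Y0.
rewrite (_ : 1%:M - Y = (1%:M - Y) *m (1%:M - Y)^T); first exact: psd_gram.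
rewrite linearB /= trmx1 Ys mulmxBl mul1mx mulmxBr mulmx1 YY subrr subr0 //.
Qed.

(** For the inclusion from right to left, diagonalize Y = V^T diag(d) V with
    orthonormal rows in V.  The constraints on Y say that d lies in the
    hypersimplex, and x |-> V^T diag(x) V is linear and sends 0/1 vectors of sum
    at most k to projections of rank at most k. *)
Lemma convex_hull_proj {R : realType} (n k : nat) :
  convex_hull (@proj_rank_le R n k) = fantope n k.
Proof.
apply/seteqP; split=> [|Y [Y0 Y1 Yk]].
  apply: smallest_sub; first exact: fantope_convex.
  exact: proj_rank_le_fantope.
move=> C [cC projC].
have [Ys Yp] := (psdP Y).1 Y0; have [_ Yp1] := (psdP _).1 Y1.
have [r [V [d [VV [YE _]]]]] := symmetric_spectral Y Ys.
pose f (x : 'rV[R]_r) := V^T *m diag_mx x *m V.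
have trf x : \tr (f x) = \sum_i x 0 i.
  by rewrite /f mxtrace_mulC mulmxA VV mul1mx mxtrace_diag.
have entry i (M : 'M_n) :
    (row i V *m M *m (row i V)^T) 0 0 = (V *m M *m V^T) i i.
  by rewrite tr_row -row_mul !mxE; apply: eq_bigr => l _; rewrite !mxE.
have VYV : V *m Y *m V^T = diag_mx d.
  by rewrite YE !mulmxA VV mul1mx -mulmxA VV mulmx1.
have dE i : d 0 i = (row i V *m Y *m (row i V)^T) 0 0.
  by rewrite entry VYV mxE eqxx mulr1n.
have rowV i : (row i V *m (row i V)^T) 0 0 = 1.
  by rewrite -[row i V in X in X *m _]mulmx1 entry mulmx1 VV mxE eqxx.
have hd : hypersimplex r k d.
  split; last by rewrite -trf /f -YE.
  move=> i; apply/andP; split.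
    by rewrite dE; have := Yp (row i V)^T; rewrite trmxK.
  have := Yp1 (row i V)^T; rewrite trmxK mulmxBr mulmxBl mulmx1 mxE.
  by rewrite rowV [X in _ + X]mxE -dE subr_ge0.
rewrite YE -/(f d).
pose C' : set (convex_lmodType 'rV[R]_r) := fun x => C (f x).
apply: (@hypersimplex_sub_convex _ _ k C' _ _ d hd).
  apply/convex_setP => x y t t0 t1 Cx Cy.
  have := convex_setP.1 cC _ _ _ t0 t1 Cx Cy.
  rewrite /C' /f raddfD /= linearZ linearZ /= mulmxDr mulmxDl.
  by rewrite -!scalemxAr -!scalemxAl.
move=> x [x01 xk] fx; apply: projC; split.
- apply: psd_congr; apply: psd_diag => i; by case/andP: (x01 i).
- rewrite /f -!mulmxA (mulmxA V) VV mul1mx (mulmxA (diag_mx x)).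
  congr (_ *m (_ *m _)); apply/matrixP => i j.
  rewrite mul_diag_mx !mxE; have : i \notin fractional x by rewrite fx inE.
  rewrite inE negb_and !negbK => /orP[] /eqP ->; rewrite ?mul0r ?mul1r //.
  by rewrite mul0rn.
- by rewrite trf.
Qed.

(** * Diagonal blocks of the lifted variable *)

Lemma diag_block_mxdiag {R : realType} {n m} (B : 'I_n -> 'M[R]_m) i :
  diag_block (\mxdiag_j B j) i = B i.
Proof. exact: submxblock_diag. Qed.

(** The quadratic form of the block is that of W on vectors supported in the
    block. *)
Lemma psd_diag_block {R : realType} {n m} (W : 'M[R]_(\sum_(j < n) m)) i :
  psd W -> psd (diag_block W i).
Proof.
move=> /psdP[Ws Wp]; apply/psdP; split=> [|v].
  by rewrite /diag_block -[in RHS]Ws tr_submxblock.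
pose u : 'cV[R]_(\sum_(j < n) m) := \mxcol_(j < n) (if j == i then v else 0).
have := Wp u.
rewrite -[W in X in X -> _](submxblockK (p_ := fun=> m) (q_ := fun=> m)).
rewrite /u tr_mxcol mul_mxrow_mxblock mul_mxrow_mxcol.
rewrite (bigD1 i) //= eqxx [X in _ *m v + X]big1 ?addr0 => [|j /negPf ->].
  rewrite (bigD1 i) //= eqxx [X in (_ + X) *m _]big1 ?addr0 // => j /negPf ->.
  by rewrite trmx0 mul0mx.
by rewrite mulmx0.
Qed.

Lemma psd_mxdiag {R : realType} {n m} (B : 'I_n -> 'M[R]_m) :
  (forall i, psd (B i)) -> psd (\mxdiag_i B i).
Proof.
move=> B0; apply/psdP; split=> [|v].
  by rewrite tr_mxdiag; apply: eq_mxdiag => i; have /psdP[] := B0 i.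
rewrite -[v](submxcolK (p_ := fun=> m)) tr_mxcol mul_mxrow_mxdiag.
rewrite mul_mxrow_mxcol summxE sumr_ge0 // => i _.
by have /psdP[_] := B0 i; apply.
Qed.

Lemma inner_mxdiag {R : realType} {n m} (B : 'I_n -> 'M[R]_m) W :
  inner (\mxdiag_i B i) W = \sum_i inner (B i) (diag_block W i).
Proof.
rewrite /inner -[W in LHS](submxblockK (p_ := fun=> m) (q_ := fun=> m)).
by rewrite tr_mxdiag mul_mxdiag_mxblock mxtrace_mxblock.
Qed.

Lemma innerC {R : realType} {p q} (A B : 'M[R]_(p, q)) : inner A B = inner B A.
Proof. by rewrite /inner -mxtrace_tr trmx_mul trmxK. Qed.

Lemma diag_block_vec {R : realType} {n m} (X : 'M[R]_(n, m)) i :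
  diag_block (vec X^T *m (vec X^T)^T) i = row_vec X i *m (row_vec X i)^T.
Proof.
rewrite /vec tr_mxcol mul_mxcol_mxrow /diag_block mxblockK.
by rewrite /row_vec tr_row.
Qed.

Lemma diag_blockD {R : realType} {n m} (V W : 'M[R]_(\sum_(j < n) m)) i :
  diag_block (V + W) i = diag_block V i + diag_block W i.
Proof. exact: submxblockD. Qed.

Lemma diag_blockB {R : realType} {n m} (V W : 'M[R]_(\sum_(j < n) m)) i :
  diag_block (V - W) i = diag_block V i - diag_block W i.
Proof. exact: submxblockB. Qed.

Theorem theorem3 (R : realType) (n m k : nat)
    (n_gt0 : (0 < n)%N) (m_gt0 : (0 < m)%N) (k_gt0 : (0 < k)%N)
    (lambda : R) (lambda_ge0 : 0 <= lambda)
    (D : 'M[R]_(n, m)) (I : Type)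
    (E : I -> 'M[R]_(n, m)) (b : I -> R)
    (H : 'I_n -> 'M[R]_m) (H_sym : forall j, H j \is symmetricmx)
    (Q : I -> 'I_n -> 'M[R]_m) (Q_sym : forall i j, Q i j \is symmetricmx) :
  value_full k lambda D (\mxdiag_(j < n) H j)
    (fun i => \mxdiag_(j < n) Q i j) E b
  = value_reduced k lambda D H Q E b.
Proof.
rewrite /value_full /value_reduced convex_hull_proj.
congr (ereal_inf (image _ _)).
apply/funext => Y; congr ereal_inf; apply/seteqP; split.
  move=> _ [X [W [W0 WX cons blk ->]]].
  exists X, (diag_block W); split=> //.
  - move=> i; split; first exact: psd_diag_block.
    by rewrite /loewner_le -diag_block_vec -diag_blockB; apply: psd_diag_block.
  - by move=> i; rewrite -inner_mxdiag.
  - congr (_%:E); rewrite -inner_mxdiag (innerC W); ring.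
move=> _ [X [S [S0 blk cons ->]]].
pose W := vec X^T *m (vec X^T)^T +
  \mxdiag_(i < n) (S i - row_vec X i *m (row_vec X i)^T).
have WS i : diag_block W i = S i.
  by rewrite diag_blockD diag_block_vec diag_block_mxdiag addrC subrK.
have T0 : psd (\mxdiag_(i < n) (S i - row_vec X i *m (row_vec X i)^T)).
  by apply: psd_mxdiag => i; case: (S0 i).
exists X, W; split.
- exact/psdD/T0/psd_gram.
- by rewrite /loewner_le /W addrC addKr.
- by move=> i; rewrite inner_mxdiag; under eq_bigr do rewrite WS.
- by under eq_bigr do rewrite WS.
- congr (_%:E).
  rewrite (innerC W) inner_mxdiag; under [in RHS]eq_bigr do rewrite WS; ring.
Qed.
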